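(* Let $i\ge 3$ and $k\ge 3$ be integers. Then: (a) $n_2(F_i,F_{i+2},F_{i+k})=\tfrac12\bigl(5F_iF_{i+2}-F_i-F_{i+2}+1\bigr)$ whenever $k\ge i+3$; (b) $n_2(F_i,F_{i+2},F_{2i+2})=\tfrac12\bigl((7F_{i+2}-6F_i-1)F_i-F_{i+2}+1\bigr)$; (c) $n_2(F_i,F_{i+2},F_{2i+1})=\tfrac12\bigl((7F_{i+2}-8F_i-1)F_i-F_{i+2}+1\bigr)$; (d) $n_2(F_i,F_{i+2},F_{2i})=\tfrac12\bigl(3F_iF_{i+2}-F_i-F_{i+2}+1\bigr)$; (e) $n_2(F_i,F_{i+2},F_{2i-1})=\tfrac12\bigl((170F_i-1)F_i+(24F_{i+2}-125F_i-1)F_{i+2}+1\bigr)$; (f) if $r=\lfloor (F_i-1)/F_k\rfloor\ge 2$ (equivalently $k\le i-2$), then $$n_2(F_i,F_{i+2},F_{i+k})=\tfrac12\bigl((F_i+4F_k-1)F_{i+2}-F_i+1\bigr)-\tfrac12\bigl(2rF_i-(r+3)(r-2)F_k\bigr)F_{k-2}.$$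
   Context: Fibonacci numbers: $F_0=0$, $F_1=1$, $F_n=F_{n-1}+F_{n-2}$. For positive integers $a_1,\dots,a_l$ with $\gcd(a_1,\dots,a_l)=1$ and an integer $n$, let $d(n;a_1,\dots,a_l)$ be the number of tuples $(x_1,\dots,x_l)$ of nonnegative integers with $a_1x_1+\dots+a_lx_l=n$. For a nonnegative integer $p$, the $p$-Sylvester number $n_p(a_1,\dots,a_l)$ is the number of nonnegative integers $n$ with $d(n;a_1,\dots,a_l)\le p$. *)

(* Defs.v *)
From mathcomp Require Import all_boot all_order all_algebra.
Set Implicit Arguments. Unset Strict Implicit. Unset Printing Implicit Defensive.

Fixpoint fib (n : nat) : nat :=
  match n with
  | 0 => 0
  | 1 => 1
  | (m.+1 as p).+1 => fib p + fib m
  end.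

(* d(n; a_1,...,a_l): number of tuples (x_1,...,x_l) of nonnegative integers
   with a_1 x_1 + ... + a_l x_l = n.  Since all a_i are positive, every such
   x_i is at most n, so ranging over 'I_n.+1 loses nothing. *)
Definition denumerant (n : nat) (a : seq nat) : nat :=
  #|[set x : (size a).-tuple 'I_n.+1 |
      \sum_(j < size a) nth 0 a j * tnth x j == n]|.

Definition is_sylvester (p : nat) (a : seq nat) (N : nat) : Prop :=
  exists s : seq nat, [/\ uniq s, size s = N &
                          forall n, (n \in s) = (denumerant n a <= p)].

(* Main.v *)
Require Import Defs.
From mathcomp Require Import all_boot all_order all_algebra.
From mathcomp Require Import zify ring.
Import GRing.Theory Num.Theory.
Local Open Scope ring_scope.

(* Put a = F_i, b = F_{i+2}, q = F_k, e = F_{k-2}; then c = F_{i+k} satisfies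
   c = q b - e a.  Write n = t b + a w with 0 <= t < a.  A solution
   a x + b y + c z = n forces y + q z = t + a l with l >= 0, and then
   x = w - (l b - z e); so d(n; a, b, c) counts the pairs (l, z) of naturals
   with q z <= t + a l whose height l b - z e is at most w.  Hence d(n) <= 2 iff
   w < w_t, the third smallest height for t, and
     n_2 = \sum_{t < a} (floor (t b / a) + w_t)
         = (a - 1) (b - 1) / 2 + \sum_{t < a} w_t.
   As 2 e <= q and 2 a <= b, rows l >= 3 are too high to matter and w_t depends
   only on floor(t / q), floor((t + a) / q), floor((t + 2 a) / q).  All cases of
   the theorem are then sums of floors. *)

(** * Solution counts for three generators *)

Lemma sum3E (a b c n : nat) (x : 3.-tuple 'I_n.+1) :
  (\sum_(j < 3) nth 0 [:: a; b; c] j * tnth x j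
   = a * nth 0 (map val x) 0 + b * nth 0 (map val x) 1 + c * nth 0 (map val x) 2)%N.
Proof.
rewrite !big_ord_recl big_ord0 addn0 addnA /=.
by case: x => [[|x [|y [|z [|]]]]] //= ?; rewrite /tnth /=.
Qed.

Lemma Posz_sum (I : Type) (r : seq I) (P : pred I) (f : I -> nat) :
  (\sum_(j <- r | P j) f j)%N%:Z = \sum_(j <- r | P j) (f j)%:Z.
Proof. exact: (big_morph Posz PoszD). Qed.

Definition tuple3 (n : nat) (P : nat * nat * nat) : 3.-tuple 'I_n.+1 :=
  [tuple inord P.1.1; inord P.1.2; inord P.2].

Lemma denumerant3_le2 (a b c n : nat) (P Q : nat * nat * nat) :
  (forall x y z, a * x + b * y + c * z = n -> (x, y, z) = P \/ (x, y, z) = Q)%N ->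
  (denumerant n [:: a; b; c] <= 2)%N.
Proof.
move=> H; apply: (@leq_trans #|[set tuple3 n P; tuple3 n Q]|); last first.
  by rewrite cards2; case: (_ != _).
apply/subset_leq_card/subsetP => x; rewrite !inE sum3E.
case: x => [[|x [|y [|z [|]]]]] //= szx /eqP /H E.
by apply/orP; case: E => <-; [left|right]; apply/eqP/val_inj; rewrite /= !inord_val.
Qed.

(** The solutions are parametrized by pairs because they will be recovered from pairs (l, z).
    Positive coefficients bound each coordinate by n, so [inord] keeps its value. *)
Lemma denumerant3_gt2 (a b c n : nat) (f : nat * nat -> nat * nat * nat)
    (P Q S : nat * nat) :
  (0 < a)%N -> (0 < b)%N -> (0 < c)%N -> uniq [:: P; Q; S] ->
  {in [:: P; Q; S] &, injective f} ->
  (forall R, R \in [:: P; Q; S] ->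
     a * (f R).1.1 + b * (f R).1.2 + c * (f R).2 = n)%N ->
  (2 < denumerant n [:: a; b; c])%N.
Proof.
move=> a0 b0 c0 uPQS injf H.
have bnd R : R \in [:: P; Q; S] ->
    [/\ (f R).1.1 < n.+1, (f R).1.2 < n.+1 & (f R).2 < n.+1]%N.
  move=> /H; move: (f R) => [[x y] z] /= E; split; nia.
pose s := map (fun R => tuple3 n (f R)) [:: P; Q; S].
have us : uniq s.
  rewrite map_inj_in_uniq // => R R' RP RP' E; apply: injf => //; move: E.
  have [h1 h2 h3] := bnd R RP; have [h1' h2' h3'] := bnd R' RP'.
  move => /(congr1 (fun x : 3.-tuple 'I_n.+1 => map val x)) /=.
  rewrite !inordK //.
  by case: (f R) => [[? ?] ?]; case: (f R') => [[? ?] ?] /= [-> -> ->].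
rewrite -[3%N]/(size s) -(card_uniqP us); apply/subset_leq_card/subsetP => x.
case/mapP => R RP ->; rewrite inE sum3E /=; have [h1 h2 h3] := bnd R RP.
by rewrite !inordK // H.
Qed.

(** * Multiples of b modulo a and their floors *)

Lemma muln_mod_inj (a b : nat) : coprime a b ->
  {in iota 0 a &, injective (fun t => t * b %% a)%N}.
Proof.
move=> co_ab t u; rewrite !mem_iota !add0n /=.
wlog tu : t u / (t <= u)%N.
  move=> W ta ua E; have [tu|/ltnW ut] := leqP t u; first exact: W.
  by apply/esym/W.
move=> ta ua /eqP; rewrite eq_sym eqn_mod_dvd ?leq_mul2r ?tu ?orbT //.
rewrite -mulnBl Gauss_dvdl // => /dvdnP [[|d] dE]; first by lia.
have : (a <= u - t)%N by rewrite dE mulSn leq_addr.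
by lia.
Qed.

Lemma perm_muln_mod (a b : nat) : (0 < a)%N -> coprime a b ->
  perm_eq [seq (t * b %% a)%N | t <- iota 0 a] (iota 0 a).
Proof.
move=> a0 co_ab; set s := map _ _.
have us : uniq s by rewrite map_inj_in_uniq ?iota_uniq //; exact: muln_mod_inj.
apply: uniq_perm => //; first exact: iota_uniq.
apply: (uniq_min_size us _ _).2; last by rewrite size_map.
by move=> x /mapP [t _ ->]; rewrite mem_iota ltn_mod.
Qed.

(** Sum t b = a floor(t b / a) + (t b mod a) over t < a: the remainders permute 0, ..., a - 1. *)
Lemma sum_floor_coprime (a b : nat) : (0 < a)%N -> coprime a b ->
  (2 * (\sum_(0 <= t < a) t * b %/ a) + a + b = a * b + 1)%N.
Proof.
move=> a0 co_ab.
have sum_mod : (\sum_(0 <= t < a) t * b %% a = \sum_(0 <= t < a) t)%N.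
  by rewrite /index_iota subn0 -[RHS](perm_big _ (perm_muln_mod a b a0 co_ab)) big_map.
have sum_id : (2 * (\sum_(0 <= t < a) t) + a = a * a)%N.
  by elim: (a) => [|n IH]; [rewrite big_geq | rewrite big_nat_recr //=; lia].
have E : ((\sum_(0 <= t < a) t * b %/ a) * a + \sum_(0 <= t < a) t
          = (\sum_(0 <= t < a) t) * b)%N.
  rewrite -{1}sum_mod !big_distrl -big_split /=.
  by apply: eq_bigr => t _; rewrite -divn_eq.
by apply/eqP; rewrite -(eqn_pmul2r a0); apply/eqP; nia.
Qed.

(** * From third smallest heights to the Sylvester number *)

Section Threshold.
Variables a b c q e : nat.
Hypotheses (a_gt0 : (0 < a)%N) (b_gt0 : (0 < b)%N) (c_gt0 : (0 < c)%N).
Hypotheses (co_ab : coprime a b) (cE : (c + e * a = q * b)%N).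

(* The pair P stands for (l, z). *)
Definition admissible (t : nat) (P : nat * nat) := (q * P.2 <= t + a * P.1)%N.
Definition height (P : nat * nat) : int := P.1%:Z * b%:Z - P.2%:Z * e%:Z.

(* [w] is the third smallest height, multiplicities counted: P and Q carry two
   smallest ones and S realizes the bound. *)
Definition third_height (t : nat) (w : int) := exists P Q S : nat * nat,
  [/\ uniq [:: P; Q; S],
      {in [:: P; Q; S], forall R, admissible t R /\ height R <= w} &
      forall R, admissible t R -> R \notin [:: P; Q] -> w <= height R].

(** Substituting c = q b - e a gives b (y + q z - t) = a (m - x + e z). Coprimality yields y + q z -
    t = a l, and cancelling a b-free factor a leaves l b - z e = m - x. *)
Lemma solution_admissible (t n x y z : nat) (m : int) :
  (t < a)%N -> n%:Z = t%:Z * b%:Z + a%:Z * m -> (a * x + b * y + c * z = n)%N ->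
  exists l, [/\ (y + q * z = t + a * l)%N & height (l, z) = m - x%:Z].
Proof.
move=> ta nE E.
have E1 : a%:Z * x%:Z + b%:Z * y%:Z + c%:Z * z%:Z = n%:Z by lia.
have E2 : c%:Z + e%:Z * a%:Z = q%:Z * b%:Z by lia.
have [l lE] : exists l : int, y%:Z + q%:Z * z%:Z - t%:Z = l * a%:Z.
  apply/dvdzP; rewrite -(@Gauss_dvdzr _ b%:Z) //.
  apply/dvdzP; exists (m - x%:Z + e%:Z * z%:Z).
  have -> : b%:Z * (y%:Z + q%:Z * z%:Z - t%:Z)
    = (a%:Z * x%:Z + b%:Z * y%:Z + c%:Z * z%:Z) - t%:Z * b%:Z
      + (q%:Z * b%:Z - c%:Z) * z%:Z - a%:Z * x%:Z by ring.
  rewrite E1 nE -E2; ring.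
(* Since t < a, the product l a = y + q z - t exceeds -a. *)
have l0 : 0 <= l by nia.
exists `|l|%N; split; first by nia.
have a0 : a%:Z != 0 by lia.
apply: (mulfI a0); rewrite /height /= gez0_abs // mulrBr !mulrA.
have -> : a%:Z * l = y%:Z + q%:Z * z%:Z - t%:Z by rewrite lE mulrC.
have -> : a%:Z * (m - x%:Z) = a%:Z * x%:Z + b%:Z * y%:Z + c%:Z * z%:Z - t%:Z * b%:Z - a%:Z * x%:Z.
  by rewrite E1 nE; ring.
have -> : c%:Z = q%:Z * b%:Z - e%:Z * a%:Z by rewrite -E2; ring.
ring.
Qed.

(** Solutions correspond to admissible pairs of height at most m. If m < w, only P and Q can
    qualify; if w <= m, all of P, Q, S do. *)
Lemma denumerant_le2 (t n : nat) (m w : int) :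
  (t < a)%N -> third_height t w -> n%:Z = t%:Z * b%:Z + a%:Z * m ->
  (denumerant n [:: a; b; c] <= 2)%N = (m < w).
Proof.
move=> ta [P [Q [S [uPQS PQS low]]]] nE.
(* [f] recovers x and y from (l, z); absolute value and truncated subtraction are harmless for
   admissible pairs of height at most m. *)
pose f (R : nat * nat) := (`|m - height R|, t + a * R.1 - q * R.2, R.2)%N.
case: ltrP => [mw|wm].
  apply: (@denumerant3_le2 _ _ _ _ (f P) (f Q)) => x y z E.
  have [l [yE hE]] := solution_admissible _ _ _ _ _ _ ta nE E.
  have adm : admissible t (l, z) by rewrite /admissible /=; lia.
  have fE : (x, y, z) = f (l, z).
    by rewrite /f hE /=; congr (_, _, _); lia.
  have [|/(low _ adm)] := boolP ((l, z) \in [:: P; Q]); last by lia.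
  by rewrite fE !inE => /orP[] /eqP ->; [left|right].
apply/negbTE; rewrite -ltnNge.
apply: (@denumerant3_gt2 _ _ _ _ f P Q S) => //.
  move=> [l z] [l' z'] /PQS [adm _] /PQS [adm' _] [_ E1 E2].
  by move: adm adm' E1; rewrite /admissible /= E2 => *; congr (_, _); nia.
move=> [l z] /PQS [adm hw]; move: adm; rewrite /f /admissible /= => adm.
have h1 : (`|(m - height (l, z))%R|%N)%:Z = m - height (l, z) by lia.
suff : a%:Z * (m - height (l, z)) + b%:Z * (t%:Z + a%:Z * l%:Z - q%:Z * z%:Z) + c%:Z * z%:Z = n%:Z.
  set y := (t + a * l - q * z)%N.
  have -> : t%:Z + a%:Z * l%:Z - q%:Z * z%:Z = y%:Z by rewrite /y; lia.
  by rewrite -h1 => /eqP; rewrite -!PoszM -!PoszD => /eqP [].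
have -> : c%:Z = q%:Z * b%:Z - e%:Z * a%:Z by lia.
by rewrite nE /height /=; ring.
Qed.

(** In the residue class of t b modulo a, exactly the first [K t] naturals have d(n) <= 2, so N is
    the sum of the [K t]. *)
Lemma sylvester_sum (w : nat -> int) :
  (forall t, (t < a)%N -> third_height t (w t)) ->
  exists N, is_sylvester 2 [:: a; b; c] N /\
    N%:Z * 2 = (a%:Z - 1) * (b%:Z - 1) + 2 * \sum_(0 <= t < a) w t.
Proof.
move=> hw; pose K t := `|((t * b %/ a)%N%:Z + w t)%R|%N.
(* The right side is nonnegative: [w t] is at least the height of an admissible (l, z), and a (l b -
   z e) + t b = b (t + a l - q z) + c z >= 0. *)
have KE t : (t < a)%N -> (K t)%:Z = (t * b %/ a)%N%:Z + w t.
  move=> ta; rewrite /K gez0_abs //.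
  have [P [Q [[l z] [_ hPQS _]]]] := hw t ta.
  have [|adm hR] := hPQS (l, z); first by rewrite !inE eqxx !orbT.
  move: adm hR {hPQS}; rewrite /admissible /height /= => adm hR.
  have := divn_eq (t * b) a; have := ltn_pmod (t * b) a_gt0.
  move: (t * b %/ a)%N (t * b %% a)%N => u v va uE.
  have : (0 <= a%:Z * (l%:Z * b%:Z - z%:Z * e%:Z) + t%:Z * b%:Z)%R.
    have -> : a%:Z * (l%:Z * b%:Z - z%:Z * e%:Z) + t%:Z * b%:Z =
       b%:Z * (t%:Z + a%:Z * l%:Z - q%:Z * z%:Z) + c%:Z * z%:Z.
      have -> : c%:Z = q%:Z * b%:Z - e%:Z * a%:Z by lia.
      ring.
    by nia.
  by nia.
pose s := [seq (t * b %% a + a * j)%N | t <- iota 0 a, j <- iota 0 (K t)].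
exists (\sum_(0 <= t < a) K t)%N; split; last first.
  have -> : (\sum_(0 <= t < a) K t)%N%:Z
      = \sum_(0 <= t < a) ((t * b %/ a)%N%:Z + w t).
    by rewrite Posz_sum; apply: eq_big_nat => t /andP [_ /KE].
  rewrite big_split /= -Posz_sum.
  have := sum_floor_coprime a b a_gt0 co_ab.
  by move: (\sum_(_ <= _ < _) _)%N (\sum_(_ <= _ < _) w _) => U W; nia.
exists s; split.
- apply: allpairs_uniq_dep; rewrite ?iota_uniq //.
    by move=> t _; exact: iota_uniq.
  move=> x y /allpairsPdep [t [j [ta jK ->]]] /allpairsPdep [u [v [ua vK ->]]] /=.
  move=> E; have Emod : (t * b %% a = u * b %% a)%N.
    have := congr1 (modn^~ a) E.
    by rewrite !modnDml /= ![(_ + a * _)%N]addnC ![(a * _)%N]mulnC !modnMDl.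
  have tu := muln_mod_inj a b co_ab t u ta ua Emod.
  move: E; rewrite tu => /addnI /eqP; rewrite eqn_pmul2l // => /eqP ->.
  by [].
- rewrite size_allpairs_dep sumnE big_map /index_iota subn0.
  by apply: eq_bigr => t _; rewrite size_iota.
move=> n; have [t ta nE] : exists2 t, t \in iota 0 a & (t * b %% a = n %% a)%N.
  have : (n %% a)%N \in iota 0 a by rewrite mem_iota ltn_mod.
  by rewrite -(perm_mem (perm_muln_mod a b a_gt0 co_ab)) => /mapP [t ? ->]; exists t.
have ta' : (t < a)%N by move: ta; rewrite mem_iota.
pose m : int := (n %/ a)%N%:Z - (t * b %/ a)%N%:Z.
rewrite (@denumerant_le2 t n m (w t)) //; last first.
  + by rewrite /m; have := divn_eq n a; have := divn_eq (t * b) a; rewrite nE; nia.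
  + exact: hw.
have -> : (m < w t) = (n %/ a < K t)%N by have := KE t ta'; rewrite /m; lia.
apply/allpairsPdep/idP => [[u [j [ua jK E]]]|nK].
  have Emod : (t * b %% a = u * b %% a)%N.
    by rewrite nE E modnDml addnC mulnC modnMDl.
  have tu := muln_mod_inj a b co_ab t u ta ua Emod.
  rewrite E addnC mulnC divnMDl // divn_small ?ltn_mod // addn0 tu.
  by move: jK; rewrite mem_iota.
exists t, (n %/ a)%N; split => //; first by rewrite mem_iota.
by rewrite nE addnC mulnC -divn_eq.
Qed.
End Threshold.

(** * The third smallest height in closed form *)

Section Formula.
Variables a b q e : nat.
Hypotheses (a_gt0 : (0 < a)%N) (q_gt0 : (0 < q)%N).
Hypotheses (le_2e_q : (2 * e <= q)%N) (le_2a_b : (2 * a <= b)%N).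

(** Chain 4 e z <= 2 q z <= 2 (t + a l) <= 2 a (l + 1) <= b (l + 1). *)
Lemma height_lower (t l z : nat) : (t < a)%N -> admissible a q t (l, z) ->
  (3 * l%:Z - 1) * b%:Z <= 4 * height b e (l, z).
Proof.
rewrite /admissible /height /= => ta adm.
have h1 : (2 * (e * z) <= q * z)%N by rewrite mulnA leq_mul2r le_2e_q orbT.
have h2 : (2 * (a * l.+1) <= b * l.+1)%N by rewrite mulnA leq_mul2r le_2a_b orbT.
nia.
Qed.

(* The row l contains z = 0, ..., floor((t + a l) / q), with heights decreasing
   in z; the cases say how many of the three smallest heights lie in row 0. *)
Definition third_val (t : nat) : int :=
  if (2 <= t %/ q)%N then (2 - (t %/ q)%N%:Z) * e%:Z
  else if (t %/ q == 1)%N then b%:Z - ((t + a) %/ q)%N%:Z * e%:Z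
  else if ((t + a) %/ q == 0)%N then 2 * b%:Z - ((t + 2 * a) %/ q)%N%:Z * e%:Z
  else b%:Z - (((t + a) %/ q)%N%:Z - 1) * e%:Z.

Lemma third_heightP (t : nat) : (t < a)%N -> third_height a b q e t (third_val t).
Proof.
move=> ta.
have admE l z : admissible a q t (l, z) = (z <= (t + a * l) %/ q)%N.
  by rewrite /admissible leq_divRL // mulnC.
have adm0 z : admissible a q t (0, z)%N = (z <= t %/ q)%N.
  by rewrite admE muln0 addn0.
have adm1 z : admissible a q t (1, z)%N = (z <= (t + a) %/ q)%N.
  by rewrite admE muln1.
have adm2 z : admissible a q t (2, z)%N = (z <= (t + 2 * a) %/ q)%N.
  by rewrite admE mulnC.
have low l z := @height_lower t l z ta.
rewrite /third_val.
move: (t %/ q)%N ((t + a) %/ q)%N ((t + 2 * a) %/ q)%N adm0 adm1 adm2 => Z M L adm0 adm1 adm2.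
(* These two bounds keep row 1 at height 0 or more and row 2 at height b or more, hence above the
   rows before them. *)
have lowM : M%:Z * e%:Z <= b%:Z.
  by have := low 1%N M; rewrite adm1 leqnn /height /= => /(_ isT); lia.
have lowL : L%:Z * e%:Z <= b%:Z.
  by have := low 2%N L; rewrite adm2 leqnn /height /= => /(_ isT); lia.
have high l z : (2 < l)%N -> admissible a q t (l, z) -> 2 * b%:Z <= height b e (l, z).
  by move=> l2 /low; nia.
case: ifP => [Z2|Z2]; last case: ifP => [/eqP Z1|/eqP Z1]; last case: ifP => [/eqP M0|/eqP M0].
(* Row 0 has three pairs of height at most 0, and later rows are positive. *)
- exists (0, Z)%N, (0, Z.-1)%N, (0, Z.-2)%N; split.
  + by rewrite !cons_uniq !inE !xpair_eqE /=; lia.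
  + by move=> R; rewrite !inE => /or3P [] /eqP ->; rewrite adm0 /height /=; split; nia.
  + move=> [[|l] z]; rewrite !inE !xpair_eqE /=.
      by rewrite adm0 /height /=; nia.
    by move=> /low; nia.
- exists (0, 0)%N, (0, 1)%N, (1, M)%N; split.
  + by rewrite !cons_uniq !inE !xpair_eqE /=; lia.
  + by move=> R; rewrite !inE => /or3P [] /eqP ->; rewrite ?adm0 ?adm1 /height /=; split; nia.
  + move=> [[|[|l]] z]; rewrite !inE !xpair_eqE /=.
    * by rewrite adm0 /height /=; lia.
    * by rewrite adm1 /height /=; nia.
    by move=> /low; nia.
(* Rows 0 and 1 have one pair each, so the lowest pair of row 2 comes third. *)
- exists (0, 0)%N, (1, 0)%N, (2, L)%N; split.
  + by rewrite !cons_uniq !inE !xpair_eqE /=; lia.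
  + by move=> R; rewrite !inE => /or3P [] /eqP ->; rewrite ?adm0 ?adm1 ?adm2 /height /=; split; nia.
  + move=> [[|[|[|l]]] z]; rewrite !inE !xpair_eqE /=.
    * by rewrite adm0 /height /=; lia.
    * by rewrite adm1 /height /=; lia.
    * by rewrite adm2 /height /=; nia.
    by move=> /high; nia.
exists (0, 0)%N, (1, M)%N, (1, M.-1)%N; split.
+ by rewrite !cons_uniq !inE !xpair_eqE /=; lia.
+ by move=> R; rewrite !inE => /or3P [] /eqP ->; rewrite ?adm0 ?adm1 /height /=; split; nia.
+ move=> [[|[|l]] z]; rewrite !inE !xpair_eqE /=.
  * by rewrite adm0 /height /=; lia.
  * by rewrite adm1 /height /=; nia.
  by move=> /low; nia.
Qed.
End Formula.

(** * Sums of floors *)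

Lemma sum_divn_shift (q m : nat) : (0 < q)%N ->
  (\sum_(0 <= t < q) (t + m) %/ q = m)%N.
Proof.
move=> q0; elim: m => [|m IH].
  by rewrite big_nat big1 // => t tq; rewrite addn0 divn_small.
(* Raising m by one trades floor(m / q) for floor((m + q) / q), which is one more. *)
have E : (\sum_(0 <= t < q.+1) (t + m) %/ q = m + (m %/ q).+1)%N.
  by rewrite big_nat_recr //= IH divnDl // divnn q0.
rewrite (eq_bigr (fun t => (t.+1 + m) %/ q)%N); last by move=> t _; rewrite addnS.
by move: E; rewrite big_nat_recl //= add0n; lia.
Qed.

(** Both endpoints are allowed: the formulas for r and r + 1 agree at n = q (r + 1). *)
Lemma sum_divn (q n r : nat) : (0 < q)%N -> (q * r <= n <= q * r.+1)%N ->
  (2 * (\sum_(0 <= t < n) t %/ q) + q * r * r.+1 = 2 * r * n)%N.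
Proof.
move=> q0; elim: n r => [|n IH] r /andP [h1 h2].
  by rewrite big_geq //; nia.
rewrite big_nat_recr //=; have [qn|nq] := leqP (q * r) n.
  have -> : (n %/ q = r)%N.
    by apply/eqP; rewrite eqn_leq leq_divRL // -ltnS ltn_divLR //; nia.
  by have := IH r; rewrite qn /=; nia.
case: r h1 h2 nq => [|r] h1 h2 nq; first by lia.
have -> : (n %/ q = r)%N.
  by apply/eqP; rewrite eqn_leq leq_divRL // -ltnS ltn_divLR //; nia.
have : (q * r <= n <= q * r.+1)%N by nia.
by move/IH; nia.
Qed.

Lemma sum_affine (f : nat -> nat) (m n : nat) (x y : int) :
  \sum_(m <= t < n) (x - (f t)%:Z * y)
  = (n - m)%N%:Z * x - (\sum_(m <= t < n) f t)%N%:Z * y.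
Proof.
by rewrite sumrB sumr_const_nat -mulr_suml Posz_sum -[x *+ _]mulr_natl natz.
Qed.

(** * Summing third heights over blocks of length q *)

Section ThirdSums.
Variables a b q e : nat.
Hypothesis q_gt0 : (0 < q)%N.

(** Here t < q <= a selects the last case of [third_val], and over a full period the quotients
    floor((t + a) / q) sum to a. *)
Lemma sum_third_block0 : (q <= a)%N ->
  \sum_(0 <= t < q) third_val a b q e t = q%:Z * (b%:Z + e%:Z) - a%:Z * e%:Z.
Proof.
move=> qa; rewrite -[X in _ - X%:Z * _](sum_divn_shift q a q_gt0) -[X in X%:Z * _ - _]subn0.
rewrite -sum_affine; apply: eq_big_nat => t /= tq.
rewrite /third_val divn_small //= ifF; last first.
  by rewrite eqn0Ngt divn_gt0 //; lia.
lia.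
Qed.

Lemma sum_third_block1 (n : nat) : (q <= n <= 2 * q)%N ->
  \sum_(q <= t < n) third_val a b q e t
  = (n - q)%N%:Z * b%:Z - (\sum_(q <= t < n) (t + a) %/ q)%N%:Z * e%:Z.
Proof.
move=> qn; rewrite -sum_affine; apply: eq_big_nat => t tq.
have tq1 : (t %/ q = 1)%N.
  by apply/eqP; rewrite eqn_leq leq_divRL // -ltnS ltn_divLR //; lia.
by rewrite /third_val tq1.
Qed.

Lemma sum_third (r : nat) : (2 <= r)%N -> (q * r < a <= q * r.+1)%N ->
  2 * \sum_(0 <= t < a) third_val a b q e t
  = 4 * q%:Z * b%:Z - 2 * r%:Z * a%:Z * e%:Z
    + (r%:Z + 3) * (r%:Z - 2) * q%:Z * e%:Z.
Proof.
move=> r2 qra.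
have qa : (2 * q <= a)%N by nia.
rewrite (@big_cat_nat _ _ _ q) //=; last by lia.
rewrite (@big_cat_nat _ _ _ (2 * q) q) //=; last by lia.
rewrite sum_third_block0 ?sum_third_block1; try lia.
have -> : (\sum_(q <= t < 2 * q) (t + a) %/ q = a + q)%N.
  rewrite -{1}[q]add0n big_addn mul2n -addnn addnK.
  rewrite -[RHS](sum_divn_shift q) //.
  by apply: eq_bigr => t _; congr (_ %/ _)%N; lia.
(* From 2 q on, the third height is -floor((t - 2 q) / q) e; [sum_divn] then applies with r - 2. *)
have -> : \sum_(2 * q <= t < a) third_val a b q e t
    = - ((\sum_(0 <= t < a - 2 * q) t %/ q)%N%:Z * e%:Z).
  rewrite -{1}[(2 * q)%N]add0n big_addn Posz_sum mulr_suml -sumrN.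
  apply: eq_big_nat => t _; rewrite /third_val divnDr ?dvdn_mull // mulnK //.
  by rewrite leq_addl PoszD; ring.
have := @sum_divn q (a - 2 * q) (r - 2) q_gt0.
move: (\sum_(_ <= _ < _) _)%N => G hG.
have {hG} : (2 * G%:Z + q%:Z * (r%:Z - 2) * (r%:Z - 1) = 2 * (r%:Z - 2) * (a%:Z - 2 * q%:Z)).
  by have : (q * (r - 2) <= a - 2 * q <= q * (r - 2).+1)%N; [nia | move/hG; nia].
have -> : (2 * q - q)%N = q by lia.
rewrite PoszD; move: G%:Z => {}G hG.
have -> : 2 * (q%:Z * (b%:Z + e%:Z) - a%:Z * e%:Z
    + (q%:Z * b%:Z - (a%:Z + q%:Z) * e%:Z - G * e%:Z))
  = 4 * q%:Z * b%:Z - 4 * a%:Z * e%:Z - (2 * G) * e%:Z by ring.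
rewrite (canRL (addrK _) hG); ring.
Qed.
End ThirdSums.

(** * Fibonacci identities and the specialized sum *)

Lemma fib_pairE (n : nat) : fib n.+2 = (fib n.+1 + fib n)%N.
Proof. by []. Qed.

Lemma fib_gt0 (n : nat) : (0 < n)%N -> (0 < fib n)%N.
Proof.
by elim: n {-2}n (leqnn n) => [|m IH] [|[|[|n]]] //; rewrite !ltnS => nm _;
   rewrite fib_pairE; have := IH n.+2; lia.
Qed.

Lemma leq_fibS (n : nat) : (fib n <= fib n.+1)%N.
Proof. by case: n => [|n] //; rewrite fib_pairE leq_addr. Qed.

Lemma coprime_fibS (n : nat) : coprime (fib n) (fib n.+1).
Proof. by elim: n => [|n IH] //; rewrite fib_pairE /coprime gcdnDl gcdnC. Qed.

(** This is the relation c + e a = q b. It propagates by the recurrence in k, so the induction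
    carries two consecutive values. *)
Lemma fib_addE (i k : nat) :
  (fib (i + k.+2) + fib k * fib i = fib k.+2 * fib i.+2)%N.
Proof.
have H n : (fib (i + n.+2) + fib n * fib i = fib n.+2 * fib i.+2 /\
            fib (i + n.+3) + fib n.+1 * fib i = fib n.+3 * fib i.+2)%N.
  elim: n => [|n [IH0 IH1]].
    by rewrite !addnS addn0 !fib_pairE; move: (fib i.+1) (fib i) => u v; rewrite /=; lia.
  split=> //; rewrite (fib_pairE n.+2) mulnDl -IH0 -IH1 (fib_pairE n).
  by rewrite !addnS (fib_pairE (i + n).+2) mulnDl; lia.
by have [] := H k.
Qed.

Lemma sylvester_fib (i k : nat) : (3 <= i)%N ->
  exists N, is_sylvester 2 [:: fib i; fib i.+2; fib (i + k.+2)] N /\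
    N%:Z * 2 = ((fib i)%:Z - 1) * ((fib i.+2)%:Z - 1)
      + 2 * \sum_(0 <= t < fib i) third_val (fib i) (fib i.+2) (fib k.+2) (fib k) t.
Proof.
move=> i3; have a0 : (0 < fib i)%N by apply: fib_gt0; lia.
apply: (@sylvester_sum _ _ _ (fib k.+2) (fib k)); rewrite ?fib_gt0 ?addnS //.
- by lia.
- by rewrite fib_pairE /coprime gcdnDr -/(coprime _ _) coprime_fibS.
- by rewrite -!addnS fib_addE.
move=> t ta; apply: third_heightP => //.
- exact: fib_gt0.
- by have := leq_fibS k; rewrite fib_pairE; lia.
- by have := leq_fibS i; rewrite fib_pairE; lia.
Qed.

Lemma half_intE (N : nat) (x : int) : N%:Z * 2 = x -> N%:R = x%:~R / 2 :> rat.
Proof. by move=> <-; rewrite rmorphM /= -pmulrn mulfK. Qed.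

Lemma sum_const_on (f : nat -> int) (m n : nat) (x : int) :
  (forall t, (m <= t < n)%N -> f t = x) ->
  \sum_(m <= t < n) f t = (n - m)%N%:Z * x.
Proof.
move=> fx; rewrite (eq_big_nat _ _ (F2 := fun=> x)) //.
by rewrite sumr_const_nat -[x *+ _]mulr_natl natz.
Qed.

(** * Third-height sums for q large or close to a *)

Lemma sum_third_large (a b q e : nat) : (3 * a <= q)%N ->
  \sum_(0 <= t < a) third_val a b q e t = 2 * a%:Z * b%:Z.
Proof.
move=> aq; rewrite (@sum_const_on _ _ _ (2 * b%:Z)); first by rewrite subn0; ring.
move=> t ta; rewrite /third_val !divn_small //=; lia.
Qed.

Lemma divn_eq1 (n q : nat) : (q <= n < 2 * q)%N -> (n %/ q = 1)%N.
Proof.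
move=> nq; have q0 : (0 < q)%N by lia.
by apply/eqP; rewrite eqn_leq leq_divRL // -ltnS ltn_divLR //; lia.
Qed.

(** Here g = F_{i-3}, h = F_{i-2}, q = b and e = a. At t = h + g = b - 2 a the quotient floor((t + 2
    a) / q) jumps from 0 to 1. *)
Lemma sum_third_i2 (a b g h : nat) :
  a = (2 * h + g)%N -> b = (5 * h + 3 * g)%N -> (0 < h)%N ->
  \sum_(0 <= t < a) third_val a b b a t = 3 * a%:Z * b%:Z - 3 * a%:Z ^+ 2.
Proof.
move=> aE bE h0; rewrite (@big_cat_nat _ _ _ (h + g)%N) //=; last by lia.
rewrite (@sum_const_on _ _ _ (2 * b%:Z)); last first.
  by move=> t ta; rewrite /third_val !divn_small //=; lia.
rewrite (@sum_const_on _ _ _ (2 * b%:Z - a%:Z)); last first.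
  move=> t ta; rewrite /third_val (@divn_small t) ?(@divn_small (t + a)) ?divn_eq1 //=; lia.
have -> : (a - (h + g) = h)%N by lia.
by rewrite subn0 aE bE !(PoszD, PoszM); ring.
Qed.

(** Now q = F_{i+1} and e = F_{i-1}; at t = h + g = q - a the quotient floor((t + a) / q) jumps from
    0 to 1. *)
Lemma sum_third_i1 (a b g h : nat) :
  a = (2 * h + g)%N -> b = (5 * h + 3 * g)%N -> (0 < h)%N ->
  \sum_(0 <= t < a) third_val a b (3 * h + 2 * g) (h + g) t
  = 3 * a%:Z * b%:Z - 4 * a%:Z ^+ 2.
Proof.
move=> aE bE h0; rewrite (@big_cat_nat _ _ _ (h + g)%N) //=; last by lia.
rewrite (@sum_const_on _ _ _ (2 * b%:Z - (h + g)%N%:Z)); last first.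
  move=> t ta; rewrite /third_val (@divn_small t) ?(@divn_small (t + a)) ?divn_eq1 //=; lia.
rewrite (@sum_const_on _ _ _ b%:Z); last first.
  by move=> t ta; rewrite /third_val (@divn_small t) ?(@divn_eq1 (t + a)) //=; lia.
have -> : (a - (h + g) = h)%N by lia.
by rewrite subn0 aE bE !(PoszD, PoszM); ring.
Qed.

Lemma sum_third_i (a b e : nat) : (0 < a)%N ->
  \sum_(0 <= t < a) third_val a b a e t = a%:Z * b%:Z.
Proof. by move=> a0; rewrite sum_third_block0 //; ring. Qed.

(** Now q = F_{i-1} = h + g and e = g. The factors on the right are 2 b - 5 a = g and 17 a - 6 b = 4
    h - g. *)
Lemma sum_third_pred_i (a b g h : nat) :
  a = (2 * h + g)%N -> b = (5 * h + 3 * g)%N -> (0 < h)%N -> (g <= h)%N ->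
  \sum_(0 <= t < a) third_val a b (h + g) g t
  = a%:Z * b%:Z - (2 * b%:Z - 5 * a%:Z) * (17 * a%:Z - 6 * b%:Z).
Proof.
move=> aE bE h0 gh.
rewrite (@big_cat_nat _ _ _ (h + g)%N) //=; last by lia.
rewrite sum_third_block0 ?sum_third_block1; try lia.
have -> : (\sum_(h + g <= t < a) (t + a) %/ (h + g) = 2 * h + (h - g))%N.
  (* After shifting t by q, use q + a = 2 q + h; then floor((t + h) / q) is 0 for t < g and 1 for g
     <= t < h. *)
  have -> : (\sum_(h + g <= t < a) (t + a) %/ (h + g)
    = \sum_(0 <= t < h) (2 + (t + h) %/ (h + g)))%N.
    rewrite -{1}[(h + g)%N]add0n big_addn; have -> : (a - (h + g) = h)%N by lia.
    apply: eq_bigr => t _; rewrite -divnMDl; last by lia.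
    by congr (_ %/ _)%N; lia.
  rewrite big_split /= sum_nat_const_nat subn0 mulnC; congr (_ + _)%N.
  rewrite (@big_cat_nat _ _ _ g) //= big_nat big1 ?add0n; last first.
    by move=> t tg; rewrite divn_small //; lia.
  rewrite -[RHS]muln1 -sum_nat_const_nat; apply: eq_big_nat => t tg.
  by rewrite divn_eq1 //; lia.
have -> : (a - (h + g) = h)%N by lia.
have -> : (2 * h + (h - g))%N%:Z = 3 * h%:Z - g%:Z by lia.
by rewrite aE bE !(PoszD, PoszM); ring.
Qed.

Theorem theorem11 (i k : nat) :
  (3 <= i)%N -> (3 <= k)%N ->
  ((* (a) *)
      (i + 3 <= k)%N ->
        exists N : nat, is_sylvester 2 [:: fib i; fib i.+2; fib (i + k)] N /\
          N%:R = (5 * (fib i)%:R * (fib i.+2)%:R - (fib i)%:R - (fib i.+2)%:R + 1)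
                 / 2 :> rat) /\
      ((* (b) *)
      exists N : nat, is_sylvester 2 [:: fib i; fib i.+2; fib (2 * i + 2)] N /\
          N%:R = ((7 * (fib i.+2)%:R - 6 * (fib i)%:R - 1) * (fib i)%:R
                  - (fib i.+2)%:R + 1) / 2 :> rat) /\
      ((* (c) *)
      exists N : nat, is_sylvester 2 [:: fib i; fib i.+2; fib (2 * i + 1)] N /\
          N%:R = ((7 * (fib i.+2)%:R - 8 * (fib i)%:R - 1) * (fib i)%:R
                  - (fib i.+2)%:R + 1) / 2 :> rat) /\
      ((* (d) *)
      exists N : nat, is_sylvester 2 [:: fib i; fib i.+2; fib (2 * i)] N /\
          N%:R = (3 * (fib i)%:R * (fib i.+2)%:R - (fib i)%:R - (fib i.+2)%:R + 1)
                 / 2 :> rat) /\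
      ((* (e) *)
      exists N : nat, is_sylvester 2 [:: fib i; fib i.+2; fib (2 * i - 1)] N /\
          N%:R = ((170 * (fib i)%:R - 1) * (fib i)%:R
                  + (24 * (fib i.+2)%:R - 125 * (fib i)%:R - 1) * (fib i.+2)%:R
                  + 1) / 2 :> rat) /\
    ((* (f) *)
      let r := ((fib i - 1) %/ fib k)%N in
      (2 <= r)%N ->
        exists N : nat, is_sylvester 2 [:: fib i; fib i.+2; fib (i + k)] N /\
          N%:R = (((fib i)%:R + 4 * (fib k)%:R - 1) * (fib i.+2)%:R
                  - (fib i)%:R + 1) / 2
                 - (2 * r%:R * (fib i)%:R
                    - (r%:R + 3) * (r%:R - 2) * (fib k)%:R) / 2
                   * (fib (k - 2))%:R :> rat).
Proof.
move=> i3 k3; case: i i3 => [|[|[|m]]] // _; set i := m.+3.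
set g := fib m; set h := fib m.+1.
have h0 : (0 < h)%N by apply: fib_gt0.
have gh : (g <= h)%N := leq_fibS m.
have f1E : fib m.+2 = (h + g)%N by rewrite fib_pairE.
have aE : fib i = (2 * h + g)%N by rewrite /i fib_pairE f1E -/h; lia.
have f2E : fib m.+4 = (3 * h + 2 * g)%N by rewrite fib_pairE f1E -/i aE; lia.
have bE : fib i.+2 = (5 * h + 3 * g)%N by rewrite fib_pairE f2E aE; lia.
have i3 : (3 <= i)%N by [].
have kE : (k - 2).+2 = k by lia.
have [Nk [sNk NkE]] := sylvester_fib i (k - 2) i3; rewrite kE in sNk NkE.
split=> [ik|].
  exists Nk; split=> //; rewrite (half_intE _ _ NkE) sum_third_large; last first.
    (* F_{i+3} = 8 h + 5 g is at least 3 a = 6 h + 3 g. *)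
    have : (fib (i + 3) <= fib k)%N by apply: (homo_leq leqnn leq_trans leq_fibS).
    by rewrite addn3 fib_pairE bE f2E aE; lia.
  by move: (fib i) (fib i.+2) => a b; ring.
split.
  have [N [sN NE]] := sylvester_fib i i i3.
  rewrite mul2n -addnn -addnA addn2; exists N; split=> //.
  rewrite (half_intE _ _ NE) (sum_third_i2 _ _ _ _ aE bE h0).
  by move: (fib i) (fib i.+2) => a b; ring.
split.
  have [N [sN NE]] := sylvester_fib i m.+2 i3.
  have -> : (2 * i + 1 = i + m.+4)%N by lia.
  exists N; split=> //; rewrite (half_intE _ _ NE) f2E f1E.
  rewrite (sum_third_i1 _ _ _ _ aE bE h0).
  by move: (fib i) (fib i.+2) => a b; ring.
split.
  have [N [sN NE]] := sylvester_fib i m.+1 i3.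
  rewrite mul2n -addnn; exists N; split=> //.
  rewrite (half_intE _ _ NE) sum_third_i; last by rewrite fib_gt0.
  by move: (fib i) (fib i.+2) => a b; ring.
split.
  (* This is q = F_{i-1}, e = F_{i-3}; for i = 3 it means e = F_0 = 0. *)
  have [N [sN NE]] := sylvester_fib i m i3.
  have -> : (2 * i - 1 = i + m.+2)%N by lia.
  exists N; split=> //; rewrite (half_intE _ _ NE) f1E.
  rewrite (sum_third_pred_i _ _ _ _ aE bE h0 gh).
  by move: (fib i) (fib i.+2) => a b; ring.
move=> r r2; exists Nk; split=> //; rewrite (half_intE _ _ NkE).
have fk0 : (0 < fib k)%N by apply: fib_gt0; lia.
(* The floor of (a - 1) / q, rather than of a / q, makes the left inequality strict. *)
have bounds : (fib k * r < fib i <= fib k * r.+1)%N.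
  have := leq_divM (fib i - 1) (fib k); have := ltn_ceil (fib i - 1) fk0.
  by rewrite -/r aE; lia.
have S2 := sum_third (fib i) (fib i.+2) (fib k) (fib (k - 2)) fk0 r r2 bounds.
rewrite S2.
by move: (fib i) (fib i.+2) (fib k) (fib (k - 2)) r {r2 bounds S2} => a b q e r; ring.
Qed.
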